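(* Let $T \in \mathbb{N} \cup \{+\infty\}$, $\mathbb{N}_{\le T} = \{0,\dots,T\}$ (or $\mathbb{N}$ if $T=+\infty$), and $\mathbb{N}_{\le T-1}$ defined analogously. Consider random regressors $M_t \in \mathbb{R}^{m\times n}$, outputs $y_{t+1}\in\mathbb{R}^m$ and noise $w_t \in \mathbb{R}^m$ with $y_{t+1} = M_t\theta^\star + w_t$ for $t \in \mathbb{N}_{\le T-1}$, where $\theta^\star\in\mathbb{R}^n$ is deterministic and unknown. Let $\mathcal{D}_t = \{M_0,y_1,M_1,\dots,y_t,M_t\}$, $W \succ 0$ a symmetric positive definite $m\times m$ matrix, $\mu\in\mathbb{R}^n$, and $P\in\mathbb{R}^{n\times n}$ symmetric positive definite. Let $V_t = \sum_{k=0}^{t-1} M_k^\top W M_k$ and let $\hat\theta_t$ be the unique minimizer of $$\|\theta-\mu\|_P^2 + \sum_{k=0}^{t-1}\|y_{k+1}-M_k\theta\|_W^2,$$ i.e. $\hat\theta_t = (P+V_t)^{-1}\left(P\mu + \sum_{k=0}^{t-1} M_k^\top W y_{k+1}\right)$. Assume (i) for a known $c_w>0$ and all $t\in\mathbb{N}_{\le T-1}$, $\mathbb{E}[e^{\nu^\top w_t}\mid\mathcal{D}_t] \le e^{\frac12 c_w^2\nu^\top W^{-1}\nu}$ for all $\nu\in\mathbb{R}^m$; and (ii) for a known $c_\theta\ge 0$, $\|\theta^\star-\mu\|_P \le c_\theta$. Let $\delta\in(0,1)$ and $$\beta_t = \sqrt{c_\theta^2 + c_w^2\log\left|I_n + P^{-1}V_t\right|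 + 2c_w^2\log(1/\delta)}.$$ Then $$\mathbb{P}\left[\|\theta^\star - \hat\theta_t\|_{P+V_t} \le \beta_t,\ \forall t\in\mathbb{N}_{\le T}\right] \ge 1-\delta.$$
   Context: For a symmetric positive definite $A$, $\|x\|_A^2 = x^\top A x$; $|A|$ denotes the determinant. The probability is over the data-generation process; $\theta^\star$ is deterministic. *)

(* Defs.v *)
From HB Require Import structures.
From mathcomp Require Import all_boot all_order all_algebra.
From mathcomp Require Import all_classical all_reals all_analysis.
Set Implicit Arguments. Unset Strict Implicit. Unset Printing Implicit Defensive.
Import Order.TTheory GRing.Theory Num.Theory.
Local Open Scope ring_scope.
Local Open Scope classical_set_scope.

Definition posdef (R : realType) (k : nat) (A : 'M[R]_k) : Prop :=
  A^T = A /\ forall x : 'cV[R]_k, x != 0 -> 0 < (x^T *m A *m x) 0 0.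

Definition wnorm (R : realType) (k : nat) (A : 'M[R]_k) (x : 'cV[R]_k) : R :=
  Num.sqrt ((x^T *m A *m x) 0 0).

(* horizon T in N u {+oo}: None = +oo, Some T = T *)
Definition le_hor (Th : option nat) (t : nat) : Prop :=
  match Th with None => True | Some T => (t <= T)%N end.
Definition lt_hor (Th : option nat) (t : nat) : Prop :=
  match Th with None => True | Some T => (t < T)%N end.

Definition data_gen (R : realType) (Ω : Type) (m n : nat)
  (M : nat -> Ω -> 'M[R]_(m, n)) (y : nat -> Ω -> 'cV[R]_m) (t : nat)
  : set (set Ω) :=
  [set A | (exists k i j (B : set R), (k <= t)%N /\ measurable B /\
              A = (fun ω => M k ω i j) @^-1` B)
        \/ (exists k i (B : set R), (1 <= k <= t)%N /\ measurable B /\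
              A = (fun ω => y k ω i 0) @^-1` B)].

Definition data_sigma (R : realType) (Ω : Type) (m n : nat)
  (M : nat -> Ω -> 'M[R]_(m, n)) (y : nat -> Ω -> 'cV[R]_m) (t : nat)
  : set (set Ω) := <<s data_gen M y t >>.

Definition Vmat (R : realType) (Ω : Type) (m n : nat)
  (M : nat -> Ω -> 'M[R]_(m, n)) (W : 'M[R]_m) (t : nat) (ω : Ω) : 'M[R]_n :=
  \sum_(0 <= k < t) ((M k ω)^T *m W *m M k ω).

Definition theta_hat (R : realType) (Ω : Type) (m n : nat)
  (M : nat -> Ω -> 'M[R]_(m, n)) (y : nat -> Ω -> 'cV[R]_m)
  (W : 'M[R]_m) (P : 'M[R]_n) (mu : 'cV[R]_n) (t : nat) (ω : Ω) : 'cV[R]_n :=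
  invmx (P + Vmat M W t ω) *m
    (P *m mu + \sum_(0 <= k < t) ((M k ω)^T *m W *m y k.+1 ω)).

Definition beta (R : realType) (Ω : Type) (m n : nat)
  (M : nat -> Ω -> 'M[R]_(m, n)) (W : 'M[R]_m) (P : 'M[R]_n)
  (cth cw delta : R) (t : nat) (ω : Ω) : R :=
  Num.sqrt (cth ^+ 2 + cw ^+ 2 * ln (\det (1%:M + invmx P *m Vmat M W t ω))
            + 2 * cw ^+ 2 * ln (delta^-1)).

(* Main.v *)
Require Import Defs.
From HB Require Import structures.
From mathcomp Require Import all_boot all_order all_algebra.
From mathcomp Require Import all_classical all_reals all_analysis.
From mathcomp Require Import measurable_realfun ring.
Set Implicit Arguments. Unset Strict Implicit. Unset Printing Implicit Defensive.
Import Order.TTheory GRing.Theory Num.Theory.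
Import numFieldNormedType.Exports.
Local Open Scope ring_scope.
Local Open Scope classical_set_scope.

(* Method of mixtures. Put b_t = sum_(k < t) M_k^T W w_k - P (theta - mu) and
   A_t = cw^2 (P + V_t). For a fixed direction x the process
   exp(b_t^T x - x^T A_t x / 2) is a supermartingale, because conditionally on
   the data its increment only involves w_t through the sub-Gaussian direction
   W M_t x. Integrating over x keeps the supermartingale property and gives a
   Gaussian integral, equal to
   C / sqrt |A_t| * exp(|theta - theta_hat_t|_(P + V_t)^2 / (2 cw^2))
   because b_t = - (P + V_t) (theta - theta_hat_t). The shift by P (theta - mu)
   in b_t plays the role of the mean of the mixing prior: it makes the initial
   value contribute |theta - mu|_P^2, and Ville's maximal inequality at the
   level corresponding to beta_t is the claim. *)

(** * Schur complements *)

Definition quadf (R : realType) n (A : 'M[R]_n) (x : 'cV[R]_n) : R :=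
  (x^T *m A *m x) 0 0.

(** The Schur complement of the top-left entry. [(dlsubmx A)^T] is written for the upper-right
    block, with which it agrees when [A] is symmetric. *)
Definition schur (R : realType) n (A : 'M[R]_(1 + n)) : 'M[R]_n :=
  drsubmx A - (A 0 0)^-1 *: (dlsubmx A *m (dlsubmx A)^T).

Section Schur.
Variables (R : realType) (n : nat) (A : 'M[R]_(1 + n)).

Lemma sym_block_mxE : A^T = A ->
  A = block_mx (A 0 0)%:M (dlsubmx A)^T (dlsubmx A) (drsubmx A).
Proof.
move=> sA; rewrite -[LHS]submxK; congr block_mx.
  by rewrite [LHS]mx11_scalar !mxE !lshift0.
by rewrite trmx_dlsub sA.
Qed.

Lemma mulmx_col_rowE (k l : nat) (u : 'M[R]_(k, 1)) (v : 'M[R]_(1, l)) i j :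
  (u *m v) i j = u i 0 * v 0 j.
Proof. by rewrite mxE big_ord1. Qed.

(** Complete the square in the first coordinate. *)
Lemma quadf_schur (x0 : 'cV[R]_1) (x : 'cV[R]_n) : A^T = A -> A 0 0 != 0 ->
  quadf A (col_mx x0 x) =
  A 0 0 * (x0 0 0 + ((dlsubmx A)^T *m x) 0 0 / A 0 0) ^+ 2 + quadf (schur A) x.
Proof.
move=> sA a0; rewrite /quadf {1}(sym_block_mxE sA) tr_col_mx mul_row_block.
rewrite mul_row_col !mulmxDl mul_mx_scalar /schur mulmxBr mulmxBl.
rewrite -scalemxAr -!scalemxAl.
have -> : x^T *m (dlsubmx A *m (dlsubmx A)^T) *m x =
  ((dlsubmx A)^T *m x)^T *m ((dlsubmx A)^T *m x).
  by rewrite trmx_mul trmxK !mulmxA.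
have -> : x^T *m dlsubmx A *m x0 = ((dlsubmx A)^T *m x)^T *m x0.
  by rewrite trmx_mul trmxK.
have -> : x0^T *m (dlsubmx A)^T *m x = x0^T *m ((dlsubmx A)^T *m x).
  by rewrite mulmxA.
set c := (dlsubmx A)^T *m x; set q := x^T *m drsubmx A *m x.
rewrite !mxE !big_ord1 !mxE; field.
by [].
Qed.

Lemma posdef_schur : posdef A ->
  [/\ 0 < A 0 0, posdef (schur A) & \det A = A 0 0 * \det (schur A)].
Proof.
move=> [sA pA0]; have pA x : x != 0 -> 0 < quadf A x by exact: pA0.
have a0 : 0 < A 0 0.
  have := pA (col_mx 1 0).
  rewrite /quadf {1}(sym_block_mxE sA) tr_col_mx mul_row_block.
  rewrite trmx0 trmx1 !mul0mx !mul1mx !addr0 mul_row_col mulmx0 addr0 mulmx1.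
  rewrite [_%:M 0 0]mxE eqxx mulr1n; apply.
  apply/eqP => /(congr1 usubmx); rewrite col_mxKu linear0 => /eqP.
  by rewrite oner_eq0.
split => //.
- split.
    rewrite /schur linearB linearZ /= trmx_mul trmxK trmx_drsub sA //.
  move=> x x0; rewrite -[X in 0 < X]/(quadf _ _).
  (* This first coordinate makes the square in [quadf_schur] vanish. *)
  have := pA (col_mx (- ((A 0 0)^-1 *: ((dlsubmx A)^T *m x))) x).
  rewrite quadf_schur ?gt_eqF//.
  set c := (_ *m x); have -> : (- ((A 0 0)^-1 *: c)) 0 0 + c 0 0 / A 0 0 = 0.
    by rewrite 2!mxE mulrC addNr.
  rewrite expr0n /= mulr0 add0r.
  apply; apply: contra x0 => /eqP /(congr1 dsubmx); rewrite col_mxKd => ->.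
  by rewrite linear0.
(* Block elimination: the left factor is unipotent, so it keeps the determinant, and it clears the
   lower-left block. *)
- have := congr1 (mulmx (block_mx 1%:M 0 (- ((A 0 0)^-1 *: dlsubmx A)) 1%:M))
                 (sym_block_mxE sA).
  rewrite mulmx_block !mul0mx !mul1mx !addr0 mul_mx_scalar scalerN scalerA.
  rewrite divff ?gt_eqF// scale1r addNr.
  rewrite mulNmx -scalemxAl [X in _ = block_mx _ _ _ X]addrC -/(schur A).
  move=> /(congr1 determinant); rewrite det_mulmx det_lblock det_ublock.
  by rewrite !det1 !mul1r det_scalar expr1.
Qed.

End Schur.

(** The determinant is the product of the successive pivots, each of which is positive. *)
Lemma posdef_det_gt0 (R : realType) n (A : 'M[R]_n) : posdef A -> 0 < \det A.
Proof.
elim: n A => [A _|n IH A pA]; first by rewrite det_mx00 ltr01.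
have [a0 pS ->] := @posdef_schur R n A pA.
by rewrite mulr_gt0// IH.
Qed.

(** Gaussian elimination of the first unknown. The value $b^T A^{-1} b$ splits off the first pivot's
    term and keeps its shape in one dimension less, which is what an induction on the dimension
    consumes. *)
Lemma schur_solve (R : realType) n (A : 'M[R]_(1 + n)) (b v : 'cV[R]_(1 + n)) :
  posdef A -> A *m v = b ->
  schur A *m dsubmx v = dsubmx b - (b 0 0 / A 0 0) *: dlsubmx A /\
  (b^T *m v) 0 0 = b 0 0 ^+ 2 / A 0 0 +
    ((dsubmx b - (b 0 0 / A 0 0) *: dlsubmx A)^T *m dsubmx v) 0 0.
Proof.
move=> pA Avb; have [a0 _ _] := posdef_schur pA; have [sA _] := pA.
have bE : b = col_mx (A 0 0 *: usubmx v + (dlsubmx A)^T *m dsubmx v)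
                (dlsubmx A *m usubmx v + drsubmx A *m dsubmx v).
  by rewrite -mul_scalar_mx -mul_block_col vsubmxK -sym_block_mxE.
have b0E : b 0 0 = A 0 0 * v 0 0 + ((dlsubmx A)^T *m dsubmx v) 0 0.
  have -> : b 0 0 = (usubmx b) 0 0 by rewrite mxE lshift0.
  by rewrite bE col_mxKu !mxE !lshift0.
have a0' : A 0 0 != 0 by rewrite gt_eqF.
have uvE : usubmx v = (v 0 0)%:M.
  by rewrite [LHS]mx11_scalar mxE lshift0.
split.
- rewrite /schur {1}bE col_mxKd mulmxBl -addrA addrC -addrA; congr (_ + _).
  rewrite uvE mul_mx_scalar -scalemxAl -mulmxA.
  rewrite [(dlsubmx A)^T *m _]mx11_scalar mul_mx_scalar scalerA.
  rewrite -[LHS]scaleNr -[X in _ = X + _]scaleNr -scalerDl.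
  congr (_ *: _); rewrite b0E; field.
  by [].
- rewrite -{1}(vsubmxK b) -{1}(vsubmxK v) tr_col_mx mul_row_col.
  rewrite linearB linearZ /= mulmxBl -scalemxAl.
  rewrite [X in X = _]mxE [X in X + _]mulmx_col_rowE [usubmx b]mx11_scalar uvE.
  have -> : usubmx b 0 0 = b 0 0 by rewrite mxE lshift0.
  rewrite tr_scalar_mx [_%:M 0 0]mxE [_%:M 0 0]mxE eqxx !mulr1n.
  rewrite [X in _ = _ + X]mxE [X in _ = _ + (_ + X)]mxE [X in _ = _ + (_ - X)]mxE.
  have -> : v 0 0 = (b 0 0 - ((dlsubmx A)^T *m dsubmx v) 0 0) / A 0 0.
    by rewrite b0E; field.
  by field.
Qed.

(** * Gaussian integrals *)

Definition mx_measurable (R : realType) d (X : measurableType d) m n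
  (f : X -> 'M[R]_(m, n)) := forall i j, measurable_fun setT (fun x => f x i j).

(** * Entrywise measurability of matrix-valued maps *)

Section MatrixMeasurability.
Variables (R : realType) (d : measure_display) (X : measurableType d).

Lemma mx_measurable_cst m n (A : 'M[R]_(m, n)) :
  mx_measurable (fun _ : X => A).
Proof. by move=> i j; exact: measurable_cst. Qed.

Lemma mx_measurableD m n (f g : X -> 'M[R]_(m, n)) :
  mx_measurable f -> mx_measurable g -> mx_measurable (fun x => f x + g x).
Proof.
move=> mf mg i j; under eq_fun do rewrite mxE.
exact: measurable_funD.
Qed.

Lemma mx_measurableN m n (f : X -> 'M[R]_(m, n)) :
  mx_measurable f -> mx_measurable (fun x => - f x).
Proof.
by move=> mf i j; under eq_fun do rewrite mxE; exact: measurableT_comp.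
Qed.

Lemma mx_measurableZ m n (a : R) (f : X -> 'M[R]_(m, n)) :
  mx_measurable f -> mx_measurable (fun x => a *: f x).
Proof.
by move=> mf i j; under eq_fun do rewrite mxE; exact: measurable_funM.
Qed.

Lemma mx_measurableM m n p (f : X -> 'M[R]_(m, n)) (g : X -> 'M[R]_(n, p)) :
  mx_measurable f -> mx_measurable g -> mx_measurable (fun x => f x *m g x).
Proof.
move=> mf mg i j; under eq_fun do rewrite mxE.
apply: measurable_sum => k; exact: measurable_funM.
Qed.

Lemma mx_measurable_tr m n (f : X -> 'M[R]_(m, n)) :
  mx_measurable f -> mx_measurable (fun x => (f x)^T).
Proof. by move=> mf i j; under eq_fun do rewrite mxE; exact: mf. Qed.

Lemma mx_measurable_sum m n (F : nat -> X -> 'M[R]_(m, n)) (t : nat) :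
  (forall k, (k < t)%N -> mx_measurable (F k)) ->
  mx_measurable (fun x => \sum_(0 <= k < t) F k x).
Proof.
elim: t => [_|t IH mF].
  by under eq_fun do rewrite big_geq//; exact: mx_measurable_cst.
under eq_fun do rewrite big_nat_recr//=.
apply: mx_measurableD; last exact: mF.
by apply: IH => k kt; apply: mF; rewrite ltnS ltnW.
Qed.

Lemma mx_measurable_comp d' (Y : measurableType d') m n (h : Y -> X)
    (f : X -> 'M[R]_(m, n)) :
  measurable_fun setT h -> mx_measurable f -> mx_measurable (fun y => f (h y)).
Proof. by move=> mh mf i j; exact: measurableT_comp (mf i j) mh. Qed.

End MatrixMeasurability.

Definition gauss_exp (R : realType) n (A : 'M[R]_n) (b x : 'cV[R]_n) : R :=
  expR ((b^T *m x) 0 0 - quadf A x / 2).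

Lemma measurable_gauss_exp (R : realType) d (X : measurableType d) n
    (A : X -> 'M[R]_n) (b x : X -> 'cV[R]_n) :
  mx_measurable A -> mx_measurable b -> mx_measurable x ->
  measurable_fun setT (fun z => gauss_exp (A z) (b z) (x z)).
Proof.
move=> mA mb mx; apply: measurableT_comp => //.
apply: measurable_funB.
  exact: (mx_measurableM (mx_measurable_tr mb) mx).
apply: measurable_funM => //.
exact: (mx_measurableM (mx_measurableM (mx_measurable_tr mx) mA) mx).
Qed.

(** The integrand is a multiple of the normal density with mean [b / a] and standard deviation [s].
    The prefactor [r] makes room for what depends on the other coordinates. *)
Lemma gauss_integral1 (R : realType) (a b r : R) : 0 < a -> 0 <= r ->
  (\int[lebesgue_measure]_x (r * expR (b * x - a * x ^+ 2 / 2))%:E =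
   (r * (Num.sqrt (pi *+ 2) / Num.sqrt a * expR (b ^+ 2 / a / 2)))%:E)%E.
Proof.
move=> a0 r0; set s := (Num.sqrt a)^-1.
have s0 : s != 0 by rewrite invr_neq0// gt_eqF// sqrtr_gt0.
have s2 : s ^+ 2 = a^-1 by rewrite exprVn sqr_sqrtr// ltW.
have peakE : normal_peak s = (Num.sqrt (pi *+ 2) / Num.sqrt a)^-1.
  rewrite /normal_peak s2 -mulrnAr sqrtrM ?invr_ge0 ?(ltW a0)//.
  by rewrite sqrtrV ?(ltW a0)// mulrC.
have c0 : Num.sqrt (pi *+ 2) / Num.sqrt a != 0 :> R.
  by rewrite -invr_eq0 -peakE gt_eqF// normal_peak_gt0.
under eq_integral => x _.
  rewrite (_ : _ * expR _ = r * (Num.sqrt (pi *+ 2) / Num.sqrt a *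
      expR (b ^+ 2 / a / 2)) * normal_pdf (b / a) s x); last first.
    rewrite normal_pdfE// peakE; move: c0; set c := _ / _ => c0.
    rewrite -[RHS]mulrA mulrACA divff// mul1r /normal_fun -expRD s2.
    congr (_ * expR _); field.
    by rewrite gt_eqF.
  over.
under eq_integral do rewrite EFinM.
rewrite ge0_integralZl_EFin//.
- by rewrite integral_normal_pdf mule1.
- by move=> x _; rewrite lee_fin normal_pdf_ge0.
- by apply/measurable_EFinP; exact: measurable_normal_pdf.
- by rewrite !mulr_ge0 ?expR_ge0 ?invr_ge0 ?sqrtr_ge0.
Qed.

(** Read through [X], the measure [g] integrates Gaussians as Lebesgue measure on $R^n$ does, up to
    scale; [v] stands for $A^{-1} b$. One [C] serves all [A] and [b], so it cancels when two such
    integrals are compared. *)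
Definition gaussian_integrals (R : realType) d (L : measurableType d) n
    (g : {sigma_finite_measure set L -> \bar R}) (X : L -> 'cV[R]_n) (C : R) :=
  forall (A : 'M[R]_n) (b v : 'cV[R]_n), posdef A -> A *m v = b ->
  (\int[g]_l (gauss_exp A b (X l))%:E =
   (C / Num.sqrt (\det A) * expR ((b^T *m v) 0 0 / 2))%:E)%E.

Section ProductSigmaFinite.
Variables (R : realType) (d1 d2 : measure_display).
Variables (T1 : measurableType d1) (T2 : measurableType d2).
Variable m1 : {sigma_finite_measure set T1 -> \bar R}.
Variable m2 : {sigma_finite_measure set T2 -> \bar R}.

(* An alias of [m1 \x m2]: on the latter, the sigma-finite structure declared
   by the library is shadowed by the one for subprobabilities. *)
Definition sf_prod : set (T1 * T2) -> \bar R := (m1 \x m2)%E.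

HB.instance Definition _ := Measure.on sf_prod.

Let sf_prod_sigma_finite : sigma_finite setT sf_prod.
Proof.
have /sigma_finiteP[F [TF ndF Foo]] := sigma_finiteT m1.
have /sigma_finiteP[G [TG ndG Goo]] := sigma_finiteT m2.
(* Both exhaustions are nondecreasing, so the diagonal rectangles cover the product: index
   [maxn i j] catches a point of [F i] and [G j]. *)
exists (fun k => F k `*` G k).
  apply/esym; rewrite -subTset => -[x y] _.
  have [i _ Fx] : (\bigcup_i F i) x by rewrite -TF.
  have [j _ Gy] : (\bigcup_j G j) y by rewrite -TG.
  exists (maxn i j) => //; split => /=.
    by move: x Fx; apply/subsetPset/ndF/leq_maxl.
  by move: y Gy; apply/subsetPset/ndG/leq_maxr.
move=> k; have [mF Fk] := Foo k; have [mG Gk] := Goo k.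
split; first exact: measurableX.
by rewrite /sf_prod product_measure1E// lte_mul_pinfty// ge0_fin_numE.
Qed.

HB.instance Definition _ :=
  Measure_isSigmaFinite.Build _ _ _ sf_prod sf_prod_sigma_finite.

End ProductSigmaFinite.

Section GaussianStep.
Variables (R : realType) (d : measure_display) (L : measurableType d) (n : nat).
Variables (g : {sigma_finite_measure set L -> \bar R}) (X : L -> 'cV[R]_n) (C : R).
Hypotheses (C0 : 0 < C) (mX : mx_measurable X) (gX : gaussian_integrals g X C).

Let mu1 : {sigma_finite_measure set (measurableTypeR R) -> \bar R} :=
  @lebesgue_measure R.

Let X1 (z : measurableTypeR R * L) : 'cV[R]_(1 + n) := col_mx z.1%:M (X z.2).

Lemma mx_measurable_cons : mx_measurable X1.
Proof.
move=> i j; rewrite ord1; rewrite /X1.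
case: (split_ordP i) => k ->.
  under eq_fun do rewrite col_mxEu ord1 mxE eqxx mulr1n.
  exact: measurable_fst.
under eq_fun do rewrite col_mxEd.
exact: measurableT_comp (mX k 0) measurable_snd.
Qed.

(* Integrate out the first coordinate: completing the square leaves the quadratic
   form of the Schur complement. *)
Lemma gaussian_integrals_cons :
  gaussian_integrals (sf_prod mu1 g) X1 (C * Num.sqrt (pi *+ 2)).
Proof.
move=> A b v pA Avb; have [a0 pS dE] := posdef_schur pA.
have [Sv bvE] := schur_solve pA Avb; have [sA _] := pA.
rewrite /sf_prod fubini_tonelli2/=; last 2 first.
- apply/measurable_EFinP; apply: measurable_gauss_exp; try exact: mx_measurable_cst.
  exact: mx_measurable_cons.
- by move=> z; rewrite lee_fin expR_ge0.
set b' := dsubmx b - (b 0 0 / A 0 0) *: dlsubmx A.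
pose K := Num.sqrt (pi *+ 2) / Num.sqrt (A 0 0) * expR (b 0 0 ^+ 2 / A 0 0 / 2).
have K0 : 0 <= K by rewrite mulr_ge0 ?expR_ge0// divr_ge0 ?sqrtr_ge0.
transitivity (\int[g]_l (K%:E * (gauss_exp (schur A) b' (X l))%:E))%E.
  apply: eq_integral => l _; rewrite /fubini_G/=.
  set c := ((dlsubmx A)^T *m X l) 0 0.
  (* [r] gathers the factors free of the first coordinate, leaving a one-dimensional Gaussian in
     [x]. *)
  set r := expR (((dsubmx b)^T *m X l) 0 0 -
                 (c ^+ 2 / A 0 0 + quadf (schur A) (X l)) / 2).
  under eq_integral => x _.
    rewrite (_ : gauss_exp _ _ _ =
        r * expR ((b 0 0 - c) * x - A 0 0 * x ^+ 2 / 2)); last first.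
      rewrite -expRD /gauss_exp quadf_schur ?gt_eqF// -/c.
      rewrite -{1}(vsubmxK b) tr_col_mx mul_row_col.
      rewrite mxE [_%:M 0 0]mxE eqxx mulr1n [((usubmx b)^T *m _) 0 0]mulmx_col_rowE.
      rewrite [_%:M 0 0]mxE [(_)^T 0 0]mxE mxE lshift0 eqxx mulr1n.
      congr expR; rewrite /=; field.
      by rewrite gt_eqF.
    over.
  rewrite gauss_integral1 ?expR_ge0// -EFinM; congr EFin.
  rewrite mulrCA /K -!mulrA; congr (_ * (_ * _)).
  rewrite /r /gauss_exp -!expRD; congr expR.
  have -> : (b'^T *m X l) 0 0 =
      ((dsubmx b)^T *m X l) 0 0 - b 0 0 / A 0 0 * c.
    rewrite [b'^T]linearB /= [(_ *: _)^T]linearZ /= mulmxBl.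
    by rewrite -[X in _ - X]scalemxAl mxE [X in _ + X]mxE [X in _ - X]mxE.
  field.
  by rewrite gt_eqF.
rewrite ge0_integralZl_EFin//; last 2 first.
- by move=> x _; rewrite lee_fin expR_ge0.
- by apply/measurable_EFinP; apply: measurable_gauss_exp => //;
    exact: mx_measurable_cst.
rewrite (gX pS Sv) -EFinM; congr EFin.
rewrite dE sqrtrM ?(ltW a0)// bvE mulrDl expRD /K invfM -/b'.
set e1 := expR _; set e2 := expR _; ring.
Qed.

End GaussianStep.

(** Iterated products of the line stand in for $R^n$, starting from a point mass in dimension 0; the
    constant built is $(2\pi)^{n/2}$. *)
Lemma gaussian_integrals_exist (R : realType) n :
  exists (d : measure_display) (L : measurableType d)
    (g : {sigma_finite_measure set L -> \bar R}) (X : L -> 'cV[R]_n) (C : R),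
  [/\ 0 < C, mx_measurable X & gaussian_integrals g X C].
Proof.
elim: n => [|n [d [L [g [X [C [C0 mX gX]]]]]]].
  exists _, unit, (dirac tt), (fun _ => 0), 1; split => //.
  move=> A b v _ _; rewrite integral_dirac//= diracT mul1e; congr EFin.
  by rewrite det_mx00 sqrtr1 invr1 !mul1r /gauss_exp /quadf !mxE !big_ord0 mul0r subr0.
exists _, (measurableTypeR R * L)%type, (sf_prod (@lebesgue_measure R) g),
  (fun z => col_mx z.1%:M (X z.2) : 'cV[R]_(1 + n)), (C * Num.sqrt (pi *+ 2)).
split.
- by rewrite mulr_gt0// sqrtr_gt0 mulrn_wgt0// pi_gt0.
- exact: (mx_measurable_cons mX).
- exact: gaussian_integrals_cons.
Qed.

(** * Conditional sub-Gaussianity along random directions *)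

Section RoundDown.
Variable R : realType.
Implicit Types (k : nat) (x : R).

Definition rdown k x : R := (Num.floor (x * k.+1%:R))%:~R / k.+1%:R.

Lemma rdown_itv k x : x - k.+1%:R^-1 <= rdown k x <= x.
Proof.
have k0 : 0 < k.+1%:R :> R by rewrite ltr0n.
have /andP[h1 h2] := floor_itv (x * k.+1%:R); apply/andP; split.
  rewrite /rdown ler_pdivlMr// mulrBl mulVf ?gt_eqF// lerBlDr.
  by rewrite ltW// -[1]/(1%:~R) -intrD.
by rewrite ler_pdivrMr.
Qed.

Lemma rdown_ge0 k x : 0 <= x -> 0 <= rdown k x.
Proof. by move=> x0; rewrite divr_ge0// ler0z floor_ge0 mulr_ge0. Qed.

Lemma cvg_rdown x : rdown k x @[k --> \oo] --> x.
Proof.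
apply: (squeeze_cvgr (f := fun k => x - harmonic k) (h := fun=> x)).
- by near=> k; exact: rdown_itv.
- by rewrite -[X in _ --> X]subr0; apply: cvgB; [exact: cvg_cst|exact: cvg_harmonic].
- exact: cvg_cst.
Unshelve. all: by end_near. Qed.

Lemma measurable_rdown k : measurable_fun setT (rdown k).
Proof.
apply: nondecreasing_measurable => // x y xy.
by rewrite /rdown ler_pM2r ?invr_gt0 ?ltr0n// ler_int le_floor// ler_pM2r ?ltr0n.
Qed.

Lemma measurable_floor_fiber k (z : int) :
  measurable [set x : R | Num.floor (x * k.+1%:R) = z].
Proof.
rewrite (_ : mkset _ = setT `&` ( *%R^~ k.+1%:R) @^-1` `[z%:~R, (z + 1)%:~R[).
  by apply: (@mulrr_measurable R).
rewrite setTI; apply/seteqP; split=> x /=; rewrite in_itv /=.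
  by move=> <-; exact: floor_itv.
exact: floor_def.
Qed.

Lemma cvg_mulmx m n p (A : nat -> 'M[R]_(m, n)) (B : nat -> 'M[R]_(n, p))
    (A0 : 'M[R]_(m, n)) (B0 : 'M[R]_(n, p)) :
  (forall i j, A k i j @[k --> \oo] --> A0 i j) ->
  (forall i j, B k i j @[k --> \oo] --> B0 i j) ->
  forall i j, (A k *m B k) i j @[k --> \oo] --> (A0 *m B0) i j.
Proof.
move=> cA cB i j; rewrite mxE; under eq_fun do rewrite mxE.
by apply: cvg_big => [|l _]; [exact: add_continuous|exact: cvgM].
Qed.

End RoundDown.

Lemma limn_einf_le (R : realType) (u : (\bar R)^nat) (c : \bar R) :
  (forall k, u k <= c)%E -> (limn_einf u <= c)%E.
Proof.
move=> uc; rewrite limn_einf_lim; apply: lime_le; first exact: is_cvg_einfs.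
apply: nearW => k; apply: le_trans (uc k).
by apply: ereal_inf_lbound; exists k => /=.
Qed.

Section SubSigmaAlgebra.
Variables (d : measure_display) (Ω : measurableType d) (G : set (set Ω)).
Hypothesis GΩ : <<s G >> `<=` measurable.

Lemma measurable_fun_sub d' (Y : measurableType d') (f : Ω -> Y) :
  measurable_fun (setT : set (g_sigma_algebraType G)) f -> measurable_fun setT f.
Proof. by move=> mf _ B mB; apply: GΩ; exact: mf. Qed.

Lemma measurable_fun_generated (R : realType) (f : Ω -> R) :
  (forall B : set R, measurable B -> G (f @^-1` B)) ->
  measurable_fun (setT : set (g_sigma_algebraType G)) f.
Proof. by move=> Gf _ B mB; rewrite setTI; apply: sub_sigma_algebra; exact: Gf. Qed.

Lemma mx_measurable_sub (R : realType) m n (f : Ω -> 'M[R]_(m, n)) :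
  mx_measurable (f : g_sigma_algebraType G -> _) -> mx_measurable f.
Proof. by move=> mf i j; exact: measurable_fun_sub (mf i j). Qed.

Variables (R : realType) (Pr : probability Ω R) (m : nat).
Variables (w : Ω -> 'cV[R]_m) (Q : 'M[R]_m).
Hypothesis mw : mx_measurable w.
Hypothesis subG : forall (nu : 'cV[R]_m) (A : set Ω), <<s G >> A ->
  (\int[Pr]_(ω in A) (expR ((nu^T *m w ω) 0 0))%:E <=
   (expR (quadf Q nu))%:E * Pr A)%E.

Let E (nu : 'cV[R]_m) ω := expR ((nu^T *m w ω) 0 0 - quadf Q nu).

Let measurable_E (nu : Ω -> 'cV[R]_m) :
  mx_measurable nu -> measurable_fun setT (fun ω => E (nu ω) ω).
Proof.
move=> mnu; apply: measurableT_comp => //; apply: measurable_funB.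
  exact: (mx_measurableM (mx_measurable_tr mnu) mw).
exact: (mx_measurableM (mx_measurableM (mx_measurable_tr mnu)
  (mx_measurable_cst Q)) mnu).
Qed.

(** For a constant direction, [u] and the normalisation come out of the integral, and the latter
    cancels the bound in [subG]. *)
Let sub_gaussian_cst (nu : 'cV[R]_m) (u : R) (A : set Ω) : 0 <= u -> <<s G >> A ->
  (\int[Pr]_(ω in A) (u * E nu ω)%:E <= \int[Pr]_(ω in A) u%:E)%E.
Proof.
move=> u0 GA; have mA := GΩ GA.
have mE : measurable_fun A (fun ω => (expR ((nu^T *m w ω) 0 0))%:E).
  apply/measurable_EFinP; apply: (@measurable_funTS).
  apply: measurableT_comp => //.
  exact: (mx_measurableM (mx_measurable_tr (mx_measurable_cst nu)) mw).
under eq_integral.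
  move=> ω _; rewrite (_ : _ * _ = u * expR (- quadf Q nu) *
    expR ((nu^T *m w ω) 0 0)); last by rewrite /E addrC expRD mulrA.
  rewrite EFinM; over.
rewrite ge0_integralZl_EFin//; last by rewrite mulr_ge0 ?expR_ge0.
rewrite integral_cst//.
apply: (@le_trans _ _ ((u * expR (- quadf Q nu))%:E *
    ((expR (quadf Q nu))%:E * Pr A))%E).
  by rewrite lee_wpmul2l ?subG// lee_fin mulr_ge0 ?expR_ge0.
by rewrite muleA -EFinM -mulrA -expRD addNr expR0 mulr1.
Qed.

(* The hypothesis is about constant directions; random ones are reached by
   rounding [nu] and [U] down to a grid, on whose countably many cells they are
   constant, and letting the mesh go to 0 with Fatou's lemma. *)
Lemma sub_gaussian_integral (U : Ω -> R) (nu : Ω -> 'cV[R]_m) :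
  measurable_fun (setT : set (g_sigma_algebraType G)) U ->
  mx_measurable (nu : g_sigma_algebraType G -> _) ->
  (forall ω, 0 <= U ω) ->
  (\int[Pr]_ω (U ω * expR (((nu ω)^T *m w ω) 0 0 - quadf Q (nu ω)))%:E <=
   \int[Pr]_ω (U ω)%:E)%E.
Proof.
move=> mU mnu U0.
pose nuk k ω : 'cV[R]_m := \col_i rdown k (nu ω i 0).
pose F k ω := rdown k (U ω) * E (nuk k ω) ω.
have mU' := measurable_fun_sub mU.
have mnuk k : mx_measurable (nuk k).
  move=> i j; under eq_fun do rewrite mxE.
  by apply: measurableT_comp; [exact: measurable_rdown|exact: mx_measurable_sub mnu i 0].
have mF k : measurable_fun setT (fun ω => (F k ω)%:E).
  apply/measurable_EFinP; apply: measurable_funM; last exact: measurable_E.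
  by apply: measurableT_comp mU'; exact: measurable_rdown.
have F0 k ω : (0 <= (F k ω)%:E)%E.
  by rewrite lee_fin mulr_ge0 ?expR_ge0// rdown_ge0.
have cnu ω i j : nuk k ω i j @[k --> \oo] --> nu ω i j.
  by under eq_fun do rewrite mxE; rewrite ord1; exact: cvg_rdown.
have cF ω : (F k ω)%:E @[k --> \oo] --> (U ω * E (nu ω) ω)%:E.
  apply: cvg_EFin; first by apply: nearW.
  apply: cvgM; first exact: cvg_rdown.
  apply: continuous_cvg; first exact: continuous_expR.
  have cnuT i j : (nuk k ω)^T i j @[k --> \oo] --> (nu ω)^T i j.
    by rewrite mxE; under eq_fun do rewrite mxE; exact: cnu.
  apply: cvgB; apply: cvg_mulmx => // i j; try exact: cvg_cst.
  by apply: cvg_mulmx => // *; exact: cvg_cst.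
(* Writing the pointwise limit as a lower limit lets Fatou's lemma reduce the claim to one fixed
   mesh [k]. *)
under eq_integral do rewrite -[X in X%:E]/(U _ * E (nu _) _) -(cvg_limn_einf_sup (cF _)).1.
apply: le_trans (fatou _ _ _ _) _ => //.
apply: limn_einf_le => k.
(* The integer coordinates [z] identify a grid cell; [pickle] numbers the cells, so that integrals
   become series over them. *)
pose z ω := (Num.floor (U ω * k.+1%:R),
  \col_i Num.floor (nu ω i 0 * k.+1%:R)) : int * 'cV[int]_m.
pose P j := [set ω | pickle (z ω) = j].
have zP j ω ω0 : P j ω -> P j ω0 -> z ω = z ω0.
  by move=> /= <- /(pcan_inj pickleK).
have mP j : <<s G >> (P j).
  have [->|/set0P[ω0 Pω0]] := eqVneq (P j) set0.
    exact: (@measurable0 _ (g_sigma_algebraType G)).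
  rewrite (_ : P j = (U @^-1` [set x | Num.floor (x * k.+1%:R) = (z ω0).1]) `&`
    \bigcap_(i in [set: 'I_m]) ((fun ω => nu ω i 0) @^-1`
      [set x | Num.floor (x * k.+1%:R) = (z ω0).2 i 0])).
    apply: (@measurableI _ (g_sigma_algebraType G)).
      rewrite -[X in _.-measurable X]setTI; apply: mU => //.
      exact: measurable_floor_fiber.
    apply: (@fin_bigcap_measurable _ (g_sigma_algebraType G)) => // i _.
    rewrite -[X in measurable X]setTI; apply: mnu => //.
    exact: measurable_floor_fiber.
  apply/seteqP; split => ω.
    move=> /zP /(_ Pω0) [zU /matrixP znu]; split => /= [|i _]; first exact: zU.
    by have := znu i 0; rewrite !mxE.
  move=> -[/= zU znu]; rewrite /P /= -Pω0; congr pickle.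
  rewrite [LHS]surjective_pairing [RHS]surjective_pairing; congr pair => //.
  by apply/matrixP => i j'; rewrite ord1 -znu// mxE.
have PT : \bigcup_j P j = setT by apply/seteqP; split => // ω _; exists (pickle (z ω)).
have tP : trivIset setT P.
  apply/trivIsetP => i j _ _ ij; apply/seteqP; split => // ω [Pi Pj].
  by move/eqP: ij; rewrite -Pi -Pj.
have mPj j : measurable (P j) := GΩ (mP j).
rewrite -PT !ge0_integral_bigcup//; last 3 first.
- by rewrite PT; apply/measurable_EFinP.
- by move=> ω _; rewrite lee_fin.
- by rewrite PT.
apply: lee_nneseries => [j _|j _].
  by move=> _; apply: integral_ge0.
have [->|/set0P[ω0 Pω0]] := eqVneq (P j) set0; first by rewrite !integral_set0.
have rdownE ω : P j ω -> rdown k (U ω) = rdown k (U ω0).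
  by move=> /zP /(_ Pω0) [zU _]; rewrite /rdown zU.
have nukE ω : P j ω -> nuk k ω = nuk k ω0.
  move=> /zP /(_ Pω0) [_ /matrixP znu]; apply/matrixP => i j'; rewrite !mxE.
  by have := znu i 0; rewrite !mxE /rdown => ->.
(* On a cell the rounded weight and direction are constant, so [sub_gaussian_cst] applies; rounding
   down then gives [rdown k (U ω) <= U ω]. *)
apply: (@le_trans _ _ (\int[Pr]_(ω in P j) (rdown k (U ω0))%:E)%E).
  rewrite (eq_integral (fun ω => (rdown k (U ω0) * E (nuk k ω0) ω)%:E)).
    by apply: sub_gaussian_cst => //; exact: rdown_ge0.
  by move=> ω /set_mem Pω; rewrite /F rdownE// nukE.
apply: ge0_le_integral => //.
- by move=> ω _; rewrite lee_fin rdown_ge0.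
- by apply/measurable_EFinP; exact: measurable_funTS.
move=> ω Pω; rewrite lee_fin -(rdownE _ Pω).
by have /andP[] := rdown_itv k (U ω).
Qed.

End SubSigmaAlgebra.

(** * Ville's inequality *)

Section Ville.
Variables (d : measure_display) (Ω : measurableType d) (R : realType).
Variables (Pr : probability Ω R) (L : nat -> Ω -> \bar R) (a z : R).
Hypotheses (mL : forall t, measurable_fun setT (L t)).
Hypothesis L0 : forall t ω, (0 <= L t ω)%E.
Hypothesis a0 : 0 < a.

Let C t := [set ω | (L t ω <= a%:E)%E].
(** The supermartingale inequality is asked only on these events, so this section needs no
    filtration. *)
Definition below_upto t := \bigcap_(s in [set s | (s <= t)%N]) C s.
Local Notation B := below_upto.

Hypothesis supermartingale :
  forall t, (\int[Pr]_(ω in B t) L t.+1 ω <= \int[Pr]_(ω in B t) L t ω)%E.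
Hypothesis init : (\int[Pr]_ω L 0 ω <= z%:E)%E.

Lemma measurable_level t : measurable (C t).
Proof.
by rewrite /C -[X in measurable X]setTI; exact: emeasurable_fun_le.
Qed.

Lemma measurable_below_upto t : measurable (B t).
Proof. by apply: bigcap_measurable => [|s _]; [exists 0|exact: measurable_level]. Qed.

(** Markov's inequality on the part of [D] above the level, keeping the integral over the rest. *)
Let markov_split t (D : set Ω) : measurable D ->
  (a%:E * Pr (D `\` C t) + \int[Pr]_(ω in D `&` C t) L t ω <=
   \int[Pr]_(ω in D) L t ω)%E.
Proof.
move=> mD; have mC := measurable_level t.
have mDC : measurable (D `\` C t) by exact: measurableD.
have mDI : measurable (D `&` C t) by exact: measurableI.
rewrite -{3}(setUIDK D (C t)) setUC ge0_integral_setU//; last 2 first.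
- exact: measurable_funTS.
- by rewrite disj_set2E; apply/eqP/seteqP; split => // ω [[_ nC] [_ /nC]].
rewrite leeD2r// -integral_cst//; apply: ge0_le_integral => //.
- by move=> ω _; rewrite lee_fin ltW.
- exact: measurable_funTS.
- by move=> ω [_ /negP]; rewrite -ltNge => /ltW.
Qed.

Lemma below_upto0 : B 0 = C 0.
Proof.
apply/seteqP; split => [ω /(_ 0%N)|ω C0 s /=]; first exact.
by rewrite leqn0 => /eqP ->.
Qed.

Lemma below_uptoS t : B t.+1 = B t `&` C t.+1.
Proof.
apply/seteqP; split => [ω BS|ω [Bt Ct] s /=].
  split => [s /= st|]; apply: BS => /=; last by [].
  exact: leqW.
by rewrite leq_eqVlt => /predU1P[->//|]; rewrite ltnS => /Bt.
Qed.

(* The left-hand side bounds from below the expectation of [L] stopped when it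
   first exceeds [a]. *)
Lemma stopped_bound t :
  (a%:E * Pr (~` B t) + \int[Pr]_(ω in B t) L t ω <= z%:E)%E.
Proof.
elim: t => [|t IH].
  apply: le_trans init; rewrite below_upto0 -setTD.
  by have := @markov_split 0 setT measurableT; rewrite setTI.
apply: le_trans IH; have mB := measurable_below_upto t.
have mC := measurable_level t.+1.
(* Either the level was exceeded by time [t], or this first happens at [t.+1]; [markov_split] on
   [B t] pays for the second case. *)
rewrite below_uptoS (_ : ~` _ = ~` B t `|` (B t `\` C t.+1)).
  rewrite measureU//; last 3 first.
  - exact: measurableC.
  - exact: measurableD.
  - by apply/seteqP; split => // ω [nB [/nB]].
  rewrite ge0_muleDr// -addeA leeD2l//.
  by apply: le_trans (supermartingale t); exact: markov_split.
apply/seteqP; split => ω /=.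
  by move=> /not_andP nBC; have [Bt|nB] := pselect (B t ω);
    [right; split => // Ct; case: nBC|left].
by move=> [nB [/nB]|[_ nC] [_ /nC]].
Qed.

Lemma ville_inequality :
  (Pr (~` (\bigcap_t [set ω | (L t ω <= a%:E)%E])) <= (z / a)%:E)%E.
Proof.
have mB t : measurable (~` B t) by exact/measurableC/measurable_below_upto.
have -> : ~` (\bigcap_t C t) = \bigcup_t (~` B t).
  rewrite -setC_bigcap; congr (~` _).
  apply/seteqP; split => [ω Ct t _ s _|ω Bt t _]; first exact: Ct.
  exact: (Bt t) (leqnn t).
have ndB : nondecreasing_seq (fun t => ~` B t).
  apply/nondecreasing_seqP => t; apply/subsetPset; rewrite below_uptoS.
  by apply: subsetC => ω [].
have cB := nondecreasing_cvg_mu (mu := Pr) mB (bigcup_measurable (fun t _ => mB t)) ndB.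
rewrite -(cvg_lim _ cB)//; apply: lime_le; first exact: cvgP cB.
apply: nearW => t /=.
rewrite mulrC EFinM lee_pdivlMl//.
apply: le_trans (stopped_bound t); rewrite leeDl//.
exact: integral_ge0.
Qed.

End Ville.

(** * The mixture supermartingale *)

Section QuadraticForms.
Variable R : realType.

Lemma quadf0 n (A : 'M[R]_n) : quadf A 0 = 0.
Proof. by rewrite /quadf mulmx0 mxE. Qed.

Lemma quadfD n (A B : 'M[R]_n) x : quadf (A + B) x = quadf A x + quadf B x.
Proof. by rewrite /quadf mulmxDr mulmxDl mxE. Qed.

Lemma quadfZ n c (A : 'M[R]_n) x : quadf (c *: A) x = c * quadf A x.
Proof. by rewrite /quadf -scalemxAr -scalemxAl mxE. Qed.

Lemma quadf_congr m n (W : 'M[R]_m) (M : 'M[R]_(m, n)) x :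
  quadf (M^T *m W *m M) x = quadf W (M *m x).
Proof. by rewrite /quadf trmx_mul !mulmxA. Qed.

Lemma posdef_quadf_ge0 n (A : 'M[R]_n) x : posdef A -> 0 <= quadf A x.
Proof.
move=> [_ pA]; have [->|/pA/ltW//] := eqVneq x 0.
by rewrite quadf0.
Qed.

Lemma posdefZ n c (A : 'M[R]_n) : 0 < c -> posdef A -> posdef (c *: A).
Proof.
move=> c0 [sA pA]; split; first by rewrite linearZ /= sA.
by move=> x /pA x0; rewrite -[X in 0 < X]/(quadf _ _) quadfZ mulr_gt0.
Qed.

Lemma posdef_unitmx n (A : 'M[R]_n) : posdef A -> A \in unitmx.
Proof. by move=> /posdef_det_gt0 dA; rewrite unitmxE unitfE gt_eqF. Qed.

Lemma sqr_wnorm n (A : 'M[R]_n) x : posdef A -> wnorm A x ^+ 2 = quadf A x.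
Proof. by move=> pA; rewrite sqr_sqrtr// posdef_quadf_ge0. Qed.

End QuadraticForms.

(** * The regularised Gram matrix and the estimation error *)

Section RegularizedGram.
Variables (R : realType) (Ω : Type) (m n : nat).
Variables (M : nat -> Ω -> 'M[R]_(m, n)) (W : 'M[R]_m) (P : 'M[R]_n).
Hypotheses (pW : posdef W) (pP : posdef P).

Lemma VmatS t ω :
  Vmat M W t.+1 ω = Vmat M W t ω + (M t ω)^T *m W *m M t ω.
Proof. by rewrite /Vmat big_nat_recr. Qed.

Lemma quadf_Vmat_ge0 t ω x : 0 <= quadf (Vmat M W t ω) x.
Proof.
elim: t => [|t IH]; first by rewrite /Vmat big_geq// /quadf mulmx0 mul0mx mxE.
by rewrite VmatS quadfD addr_ge0// quadf_congr posdef_quadf_ge0.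
Qed.

Lemma posdef_gram t ω : posdef (P + Vmat M W t ω).
Proof.
split; last first.
  move=> x x0; rewrite -[X in 0 < X]/(quadf _ _) quadfD.
  by rewrite ltr_pwDl// ?quadf_Vmat_ge0//; exact: pP.2.
rewrite linearD /= pP.1; congr (_ + _).
elim: t => [|t IH]; first by rewrite /Vmat big_geq// trmx0.
by rewrite VmatS linearD /= IH !trmx_mul trmxK pW.1 mulmxA.
Qed.

(** Factor $P + V_t = P (I + P^{-1} V_t)$. The determinant in [beta] thus becomes a ratio of two
    Gaussian normalisers. *)
Lemma det_gram_ratio t ω :
  \det (1%:M + invmx P *m Vmat M W t ω) =
  \det (P + Vmat M W t ω) / \det P.
Proof.
have uP := posdef_unitmx pP.
rewrite -{1}(mulVmx uP) -mulmxDr det_mulmx det_inv mulrC.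
by [].
Qed.

Variables (mu : 'cV[R]_n) (y : nat -> Ω -> 'cV[R]_m) (theta : 'cV[R]_n).

(** This is $b_t$: for symmetric [P] and [W], minus half the gradient at [theta] of the regularised
    least-squares objective. Residuals replace the noise, which makes it a function of the data. *)
Definition score t ω : 'cV[R]_n :=
  \sum_(0 <= k < t) ((M k ω)^T *m W *m (y k.+1 ω - M k ω *m theta)) -
  P *m (theta - mu).

Lemma scoreS t ω : score t.+1 ω =
  score t ω + (M t ω)^T *m W *m (y t.+1 ω - M t ω *m theta).
Proof. by rewrite /score big_nat_recr//= addrAC. Qed.

(** Subtract the normal equations solved by [theta_hat] from the same expression at [theta]. *)
Lemma gram_error t ω :
  (P + Vmat M W t ω) *m (theta - theta_hat M y W P mu t ω) = - score t ω.
Proof.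
rewrite mulmxBr mulKVmx ?posdef_unitmx//; last exact: posdef_gram.
rewrite /score opprB mulmxDl mulmxBr -!addrA; congr (_ + _).
rewrite opprD addrCA; congr (_ + _).
under [X in _ = - X]eq_bigr do rewrite mulmxBr mulmxA.
by rewrite sumrB opprB /Vmat mulmx_suml.
Qed.

End RegularizedGram.

Lemma mx_measurable_Vmat (R : realType) d (X : measurableType d) m n
    (M : nat -> X -> 'M[R]_(m, n)) (W : 'M[R]_m) t :
  (forall k, (k < t)%N -> mx_measurable (M k)) -> mx_measurable (Vmat M W t).
Proof.
move=> mM; apply: mx_measurable_sum => k kt.
apply: mx_measurableM; last exact: mM.
by apply: mx_measurableM; [exact/mx_measurable_tr/mM|exact: mx_measurable_cst].
Qed.

Lemma mx_measurable_score (R : realType) d (X : measurableType d) m n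
    (M : nat -> X -> 'M[R]_(m, n)) (y : nat -> X -> 'cV[R]_m)
    (W : 'M[R]_m) (P : 'M[R]_n) mu theta t :
  (forall k, (k < t)%N -> mx_measurable (M k)) ->
  (forall k, (k < t)%N -> mx_measurable (y k.+1)) ->
  mx_measurable (score M W P mu y theta t).
Proof.
move=> mM my; apply: mx_measurableD; last exact: mx_measurable_cst.
apply: mx_measurable_sum => k kt; apply: mx_measurableM.
  by apply: mx_measurableM; [exact/mx_measurable_tr/mM|exact: mx_measurable_cst].
apply: mx_measurableD; first exact: my.
by apply/mx_measurableN/mx_measurableM; [exact: mM|exact: mx_measurable_cst].
Qed.

Section Mixture.
Variables (R : realType) (m n : nat) (W : 'M[R]_m) (P : 'M[R]_n).
Variables (mu theta : 'cV[R]_n) (cw : R).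
Variables (dL : measure_display) (Λ : measurableType dL).
Variables (g : {sigma_finite_measure set Λ -> \bar R}) (X : Λ -> 'cV[R]_n).
Hypothesis mX : mx_measurable X.

Section MixtureDef.
Variables (Ω : Type) (M : nat -> Ω -> 'M[R]_(m, n)) (y : nat -> Ω -> 'cV[R]_m).

Definition mixand t ω l : R :=
  gauss_exp (cw ^+ 2 *: (P + Vmat M W t ω)) (score M W P mu y theta t ω) (X l).

Definition mixture t ω : \bar R := (\int[g]_l (mixand t ω l)%:E)%E.

Lemma mixand_ge0 t ω l : 0 <= mixand t ω l.
Proof. exact: expR_ge0. Qed.

Lemma mixture_ge0 t ω : (0 <= mixture t ω)%E.
Proof. by apply: integral_ge0 => l _; rewrite lee_fin mixand_ge0. Qed.

(** With [nu = W M_t x] one has $\nu^T W^{-1} \nu = x^T M_t^T W M_t x$, so the growth of the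
    quadratic penalty is exactly the sub-Gaussian exponent. *)
Lemma mixandS t ω l (w : 'cV[R]_m) : posdef W ->
  y t.+1 ω = M t ω *m theta + w ->
  let nu := W *m M t ω *m X l in
  mixand t.+1 ω l = mixand t ω l *
    expR ((nu^T *m w) 0 0 - quadf (cw ^+ 2 / 2 *: invmx W) nu).
Proof.
move=> pW yE nu; rewrite /mixand VmatS scoreS {}yE [_ + w - _]addrAC subrr add0r.
rewrite /gauss_exp -expRD; congr expR.
rewrite addrA scalerDr quadfD [(_ + _)^T]linearD /= mulmxDl [(_ + _ *m _) 0 0]mxE.
have -> : ((M t ω)^T *m W *m w)^T *m X l = (nu^T *m w)^T.
  by rewrite /nu !trmx_mul !trmxK pW.1 !mulmxA.
rewrite [(_^T) 0 0]mxE.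
have -> : quadf (cw ^+ 2 / 2 *: invmx W) nu =
    quadf (cw ^+ 2 *: ((M t ω)^T *m W *m M t ω)) (X l) / 2.
  rewrite !quadfZ quadf_congr mulrAC; congr (_ * _ / _).
  rewrite /nu -mulmxA /quadf trmx_mul pW.1 -!mulmxA.
  by rewrite [invmx W *m _]mulmxA mulVmx ?posdef_unitmx// mul1mx.
ring.
Qed.

End MixtureDef.

Lemma measurable_mixand d (Ω : measurableType d) M y t :
  (forall k, (k < t)%N -> mx_measurable (M k : Ω -> _)) ->
  (forall k, (k < t)%N -> mx_measurable (y k.+1 : Ω -> _)) ->
  measurable_fun setT (fun z : Ω * Λ => mixand M y t z.1 z.2).
Proof.
move=> mM my; apply: measurable_gauss_exp.
- apply/mx_measurableZ/mx_measurableD; first exact: mx_measurable_cst.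
  exact: mx_measurable_comp measurable_fst (mx_measurable_Vmat _ mM).
- exact: mx_measurable_comp measurable_fst (mx_measurable_score _ _ _ _ mM my).
- exact: mx_measurable_comp measurable_snd mX.
Qed.

(** The measurable space is left arbitrary so that [Ω] can also be taken with a data
    sigma-algebra. *)
Lemma measurable_mixture d (Ω : measurableType d) M y t :
  (forall k, (k < t)%N -> mx_measurable (M k : Ω -> _)) ->
  (forall k, (k < t)%N -> mx_measurable (y k.+1 : Ω -> _)) ->
  measurable_fun setT (mixture M y t).
Proof.
move=> mM my; apply: (measurable_fun_fubini_tonelli_F
  (fun z : Ω * Λ => (mixand M y t z.1 z.2)%:E)).
  by apply/measurable_EFinP; exact: measurable_mixand.
by move=> z; rewrite lee_fin mixand_ge0.
Qed.

(** Exchanging the integrals reduces comparisons of mixtures to comparisons at a fixed direction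
    [X l]. *)
Lemma mixture_tonelli d (Ω : measurableType d) (Pr : probability Ω R) M y t A :
  (forall k, (k < t)%N -> mx_measurable (M k : Ω -> _)) ->
  (forall k, (k < t)%N -> mx_measurable (y k.+1 : Ω -> _)) ->
  measurable A ->
  (\int[Pr]_(ω in A) mixture M y t ω =
   \int[g]_l \int[Pr]_ω (\1_A ω * mixand M y t ω l)%:E)%E.
Proof.
move=> mM my mA.
rewrite -(@fubini_tonelli _ _ _ _ _ Pr g
  (fun z => (\1_A z.1 * mixand M y t z.1 z.2)%:E)) /=; last 2 first.
- apply/measurable_EFinP/measurable_funM; last exact: measurable_mixand.
  exact: measurableT_comp measurable_fst.
- by move=> z; rewrite lee_fin mulr_ge0// mixand_ge0.
rewrite integral_mkcond; apply: eq_integral => ω _.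
rewrite patchE indicE; case: ifPn => _.
  by apply: eq_integral => l _; rewrite mul1r.
by rewrite integral0_eq// => l _; rewrite mul0r.
Qed.

End Mixture.

(** * The data sigma-algebras *)

Section DataSigma.
Variables (R : realType) (d : measure_display) (Ω : measurableType d) (m n : nat).
Variables (M : nat -> Ω -> 'M[R]_(m, n)) (y : nat -> Ω -> 'cV[R]_m).

Lemma data_sigma_sub t :
  (forall k, mx_measurable (M k)) ->
  (forall k, (k < t)%N -> mx_measurable (y k.+1)) ->
  data_sigma M y t `<=` measurable.
Proof.
move=> mM my; apply: smallest_sub; first exact: sigma_algebra_measurable.
move=> A [[k [i [j [B [_ [mB ->]]]]]]|[k [i [B [/andP[k1 kt] [mB ->]]]]]].
  by rewrite -[X in measurable X]setTI; exact: mM.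
rewrite -[X in measurable X]setTI; case: k k1 kt => // k _ kt.
exact: my.
Qed.

Lemma mx_measurable_data_M t k : (k <= t)%N ->
  mx_measurable (M k : g_sigma_algebraType (data_gen M y t) -> _).
Proof.
move=> kt i j; apply: measurable_fun_generated => B mB.
by left; exists k, i, j, B.
Qed.

Lemma mx_measurable_data_y t k : (k < t)%N ->
  mx_measurable (y k.+1 : g_sigma_algebraType (data_gen M y t) -> _).
Proof.
move=> kt i j; apply: measurable_fun_generated => B mB.
by right; exists k.+1, i, B; rewrite ord1.
Qed.

End DataSigma.

Section Supermartingale.
Variables (R : realType) (d : measure_display) (Ω : measurableType d).
Variables (Pr : probability Ω R) (m n : nat).
Variables (M : nat -> Ω -> 'M[R]_(m, n)) (y : nat -> Ω -> 'cV[R]_m).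
Variables (w : Ω -> 'cV[R]_m) (W : 'M[R]_m) (P : 'M[R]_n).
Variables (mu theta : 'cV[R]_n) (cw : R) (t : nat).
Variables (dL : measure_display) (Λ : measurableType dL).
Variables (g : {sigma_finite_measure set Λ -> \bar R}) (X : Λ -> 'cV[R]_n).
Hypotheses (mX : mx_measurable X) (mw : mx_measurable w).
Hypothesis mM : forall k, mx_measurable (M k).
Hypothesis my : forall k, (k < t.+1)%N -> mx_measurable (y k.+1).
Hypothesis yE : forall ω, y t.+1 ω = M t ω *m theta + w ω.
Hypothesis pW : posdef W.
Hypothesis subG : forall (nu : 'cV[R]_m) (A : set Ω), data_sigma M y t A ->
  (\int[Pr]_(ω in A) (expR ((nu^T *m w ω) 0 0))%:E <=
   (expR (cw ^+ 2 / 2 * (nu^T *m invmx W *m nu) 0 0))%:E * Pr A)%E.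

(** At a fixed direction, the weight [\1_A ω * mixand] at time [t] and the vector
    [W *m M t ω *m X l] depend only on the data up to [t], which include [M t];
    [sub_gaussian_integral] then absorbs the factor from [mixandS]. *)
Lemma mixture_supermartingale (A : set Ω) : data_sigma M y t A ->
  (\int[Pr]_(ω in A) mixture W P mu theta cw g X M y t.+1 ω <=
   \int[Pr]_(ω in A) mixture W P mu theta cw g X M y t ω)%E.
Proof.
move=> GA; have GΩ : <<s data_gen M y t >> `<=` measurable.
  by apply: data_sigma_sub => // k kt; apply: my; exact: ltnW.
have mA := GΩ _ GA.
have my' k : (k < t)%N -> mx_measurable (y k.+1) by move=> kt; apply: my; exact: ltnW.
have mint s : (forall k, (k < s)%N -> mx_measurable (y k.+1)) ->
    measurable_fun setT (fun l => \int[Pr]_ω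
      (\1_A ω * mixand W P mu theta cw X M y s ω l)%:E)%E.
  move=> mys; apply: (@measurable_fun_fubini_tonelli_G _ _ _ _ _ Pr
    (fun z : Ω * Λ => (\1_A z.1 * mixand W P mu theta cw X M y s z.1 z.2)%:E)).
    apply/measurable_EFinP/measurable_funM; last exact: measurable_mixand.
    exact: measurableT_comp measurable_fst.
  by move=> z; rewrite lee_fin mulr_ge0// mixand_ge0.
have tonS := mixture_tonelli W P mu theta cw g mX Pr (fun k _ => mM k) my mA.
have ton := mixture_tonelli W P mu theta cw g mX Pr (fun k _ => mM k) my' mA.
(* A plain [rewrite] would try to unify the mixtures at [t] and [t.+1]. *)
refine (eq_ind_r (fun z => (z <= _)%E) (eq_ind_r (fun z => (_ <= z)%E) _ ton) tonS).
apply: ge0_le_integral.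
- exact: measurableT.
- by move=> l _; apply: integral_ge0 => ω _; rewrite lee_fin mulr_ge0// mixand_ge0.
- exact: mint.
- exact: mint.
move=> l _.
under eq_integral do rewrite (mixandS P mu cw X l pW (yE _)) mulrA.
apply: (sub_gaussian_integral GΩ) => //.
- by move=> nu B GB; rewrite quadfZ; exact: subG.
- apply: measurable_funM; first exact: measurable_indic.
  apply: measurable_gauss_exp; last exact: mx_measurable_cst.
    apply/mx_measurableZ/mx_measurableD; first exact: mx_measurable_cst.
    by apply: mx_measurable_Vmat => k kt; apply: mx_measurable_data_M; exact: ltnW.
  apply: mx_measurable_score => k kt; last exact: mx_measurable_data_y.
  by apply: mx_measurable_data_M; exact: ltnW.
- apply: mx_measurableM; last exact: mx_measurable_cst.
  by apply: mx_measurableM; [exact: mx_measurable_cst|exact: mx_measurable_data_M].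
- by move=> ω; rewrite mulr_ge0// mixand_ge0.
Qed.

End Supermartingale.

(** * The confidence level *)

Section ConfidenceLevel.
Variables (R : realType) (Ω : Type) (m n : nat).
Variables (M : nat -> Ω -> 'M[R]_(m, n)) (y : nat -> Ω -> 'cV[R]_m).
Variables (W : 'M[R]_m) (P : 'M[R]_n) (mu theta : 'cV[R]_n) (cw cth delta : R).
Variables (dL : measure_display) (Λ : measurableType dL).
Variables (g : {sigma_finite_measure set Λ -> \bar R}) (X : Λ -> 'cV[R]_n) (C : R).
Hypotheses (C0 : 0 < C) (mX : mx_measurable X) (gX : gaussian_integrals g X C).
Hypotheses (pW : posdef W) (pP : posdef P) (cw0 : 0 < cw) (delta0 : 0 < delta < 1).

Let c0 : 0 < cw ^+ 2. Proof. exact: exprn_gt0. Qed.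

(** By [gram_error], the estimation error scaled by [- (cw ^+ 2)^-1] solves the linear system in
    [gaussian_integrals]. *)
Lemma mixtureE t ω : mixture W P mu theta cw g X M y t ω =
  (C / Num.sqrt (\det (cw ^+ 2 *: (P + Vmat M W t ω))) *
   expR (wnorm (P + Vmat M W t ω) (theta - theta_hat M y W P mu t ω) ^+ 2
         / cw ^+ 2 / 2))%:E.
Proof.
have pG := posdef_gram M pW pP t ω.
have GE := gram_error M pW pP mu y theta t ω.
set S := P + _ in pG GE *; set e := theta - _ in GE *.
rewrite /mixture /mixand (gX (v := - ((cw ^+ 2)^-1 *: e))).
- congr (_ * expR (_ / 2))%:E; rewrite sqr_wnorm//.
  rewrite -[score _ _ _ _ _ _ _ _]opprK -GE [(- _)^T]linearN mulmxN /=.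
  rewrite mulNmx opprK -scalemxAr trmx_mul pG.1 mxE.
  by rewrite mulrC.
- exact: posdefZ.
- by rewrite mulmxN -scalemxAl -scalemxAr scalerA divff ?gt_eqF// scale1r GE opprK.
Qed.

(* Comparing the two Gaussian integrals avoids any spectral argument. *)
Lemma det_gram_ge t ω : \det P <= \det (P + Vmat M W t ω).
Proof.
have pG := posdef_gram M pW pP t ω.
have D0 := posdef_det_gt0 pP; have D1 := posdef_det_gt0 pG.
have : (\int[g]_l (gauss_exp (P + Vmat M W t ω) 0 (X l))%:E <=
        \int[g]_l (gauss_exp P 0 (X l))%:E)%E.
  have mg (A : 'M[R]_n) : measurable_fun setT (fun l => (gauss_exp A 0 (X l))%:E).
    by apply/measurable_EFinP; apply: measurable_gauss_exp => //;
      exact: mx_measurable_cst.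
  apply: ge0_le_integral => //.
  - by move=> l _; rewrite lee_fin expR_ge0.
  move=> l _; rewrite lee_fin ler_expR lerD2l lerN2 ler_pM2r ?invr_gt0//.
  by rewrite quadfD lerDl quadf_Vmat_ge0.
rewrite (gX (v := 0) pG) ?mulmx0// (gX (v := 0) pP) ?mulmx0// lee_fin.
rewrite mxE mul0r expR0 !mulr1 ler_pM2l// lef_pV2 ?posrE ?sqrtr_gt0//.
by rewrite ler_sqrt// ltW.
Qed.

Lemma sqrt_expR_ln (r : R) : 0 < r -> Num.sqrt r = expR (ln r / 2).
Proof.
move=> r0; apply: (@pexpIrn _ 2) => //; rewrite ?nnegrE ?sqrtr_ge0 ?expR_ge0//.
by rewrite sqr_sqrtr ?(ltW r0)// -expRM_natl mulrC divfK// lnK// posrE.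
Qed.

(** The initial value of the mixture, with [cth] in place of [wnorm P (theta - mu)], divided by
    [delta]. *)
Definition mixture_level : R :=
  C / Num.sqrt (\det (cw ^+ 2 *: P)) * expR (cth ^+ 2 / cw ^+ 2 / 2) / delta.

Lemma mixture_le_level t ω :
  (mixture W P mu theta cw g X M y t ω <= mixture_level%:E)%E =
  (wnorm (P + Vmat M W t ω) (theta - theta_hat M y W P mu t ω) <=
   beta M W P cth cw delta t ω).
Proof.
have pG := posdef_gram M pW pP t ω.
have D0 := posdef_det_gt0 pP; have D1 := posdef_det_gt0 pG.
have DD := det_gram_ge t ω.
have [d0 d1] := andP delta0.
rewrite mixtureE lee_fin /mixture_level /beta det_gram_ratio// !detZ.
set N := wnorm _ _; set D := \det (P + _) in D1 DD *.
(* A ratio of at least 1 has a nonnegative logarithm; with [delta < 1] this makes the radicand of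
   [beta] nonnegative. *)
have r1 : 1 <= D / \det P by rewrite ler_pdivlMr// mul1r.
have r0 : 0 < D / \det P by rewrite divr_gt0.
have l0 : 0 <= ln (D / \det P) by exact: ln_ge0.
have ld0 : 0 <= ln delta^-1 by rewrite ln_ge0// invf_ge1// ltW.
have cn0 : 0 < (cw ^+ 2) ^+ n by exact: exprn_gt0.
have s0 : 0 < C / Num.sqrt ((cw ^+ 2) ^+ n * \det P).
  by rewrite divr_gt0// sqrtr_gt0 mulr_gt0.
(* Move the determinant ratio into the exponent, so that both sides share one constant and only
   exponents remain to be compared. *)
have -> : C / Num.sqrt ((cw ^+ 2) ^+ n * D) * expR (N ^+ 2 / cw ^+ 2 / 2) =
    C / Num.sqrt ((cw ^+ 2) ^+ n * \det P) *
    expR (N ^+ 2 / cw ^+ 2 / 2 - ln (D / \det P) / 2).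
  have DE : D = \det P * (D / \det P) by rewrite mulrC divfK// lt0r_neq0.
  have SE : Num.sqrt ((cw ^+ 2) ^+ n * D) =
      Num.sqrt ((cw ^+ 2) ^+ n * \det P) * Num.sqrt (D / \det P).
    by rewrite -sqrtrM ?mulr_ge0 ?(ltW D0) ?(ltW cn0)// -mulrA -DE.
  rewrite expRD expRN -sqrt_expR_ln// SE invfM; ring.
rewrite -[delta^-1 in LHS](@lnK R) ?posrE ?invr_gt0//.
rewrite -[_ * expR _ * expR _]mulrA -expRD ler_pM2l// ler_expR.
have N0 : 0 <= N by exact: sqrtr_ge0.
have rad0 : 0 <= cth ^+ 2 + cw ^+ 2 * ln (D / \det P) + 2 * cw ^+ 2 * ln delta^-1.
  have c0' := ltW c0; apply: addr_ge0; last by apply: mulr_ge0 => //; exact: mulr_ge0.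
  by apply: addr_ge0; [exact: sqr_ge0|exact: mulr_ge0].
rewrite -[in RHS](ger0_norm N0) -sqrtr_sqr ler_sqrt// lerBlDr.
have c20 : 0 < 2 * cw ^+ 2 by rewrite mulr_gt0.
rewrite -(ler_pM2l c20); congr (_ <= _); field; exact: lt0r_neq0.
Qed.

End ConfidenceLevel.

(** * Finite and infinite horizons *)

Section Horizon.
Variable Th : option nat.

(** Freezing time at the horizon gives a process indexed by all naturals, so one maximal inequality
    covers both cases. *)
Definition stop_at t := if Th is Some T then minn t T else t.

Lemma le_hor_stop_at t : le_hor Th (stop_at t).
Proof. by rewrite /stop_at /le_hor; case: Th => // T; exact: geq_minr. Qed.

Lemma stop_at_id t : le_hor Th t -> stop_at t = t.
Proof. by rewrite /stop_at /le_hor; case: Th => // T /minn_idPl. Qed.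

Lemma lt_hor_le_hor t s : (s <= t)%N -> lt_hor Th t -> le_hor Th s.
Proof.
by rewrite /lt_hor /le_hor; case: Th => // T st tT; exact: leq_trans (ltnW tT).
Qed.

Lemma le_hor_lt_hor t s : (s < t)%N -> le_hor Th t -> lt_hor Th s.
Proof. by rewrite /lt_hor /le_hor; case: Th => // T; exact: leq_trans. Qed.

Lemma stop_at_after t : ~ lt_hor Th t -> stop_at t.+1 = stop_at t.
Proof.
rewrite /lt_hor /stop_at; case: Th => [T /negP|//]; rewrite -leqNgt => Tt.
by rewrite (minn_idPr Tt) (minn_idPr (leqW Tt)).
Qed.

End Horizon.

Theorem theorem2 (R : realType) (d : measure_display) (Ω : measurableType d)
  (Pr : probability Ω R) (m n : nat) (Th : option nat)
  (M : nat -> Ω -> 'M[R]_(m, n)) (y : nat -> Ω -> 'cV[R]_m)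
  (w : nat -> Ω -> 'cV[R]_m) (theta : 'cV[R]_n)
  (W : 'M[R]_m) (mu : 'cV[R]_n) (P : 'M[R]_n) (cw cth delta : R) :
  (forall k i j, measurable_fun setT (fun ω => M k ω i j)) ->
  (forall k i, measurable_fun setT (fun ω => w k ω i 0)) ->
  (forall t ω, lt_hor Th t -> y t.+1 ω = M t ω *m theta + w t ω) ->
  posdef W -> posdef P ->
  0 < cw ->
  (* (i) conditional sub-Gaussianity: E[exp(nu^T w_t) | D_t] <= exp(cw^2/2 nu^T W^-1 nu),
     stated via the defining property of conditional expectation on events of sigma(D_t) *)
  (forall t, lt_hor Th t -> forall nu : 'cV[R]_m, forall A : set Ω,
     data_sigma M y t A ->
     (\int[Pr]_(ω in A) (expR ((nu^T *m w t ω) 0 0))%:E <=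
      (expR (cw ^+ 2 / 2 * (nu^T *m invmx W *m nu) 0 0))%:E * Pr A)%E) ->
  0 <= cth ->
  wnorm P (theta - mu) <= cth ->
  0 < delta < 1 ->
  (Pr [set ω | forall t, le_hor Th t ->
        (wnorm (P + Vmat M W t ω) (theta - theta_hat M y W P mu t ω)
          <= beta M W P cth cw delta t ω)%R] >= (1 - delta)%:E)%E.
Proof.
move=> mM0 mw0 yE pW pP cw0 subG cth0 xP dlt.
have [dL [Λ [g [X [C [C0 mX gX]]]]]] := gaussian_integrals_exist R n.
have mM k : mx_measurable (M k) := mM0 k.
have mw t : mx_measurable (w t) by move=> i j; rewrite ord1; exact: mw0.
(* Outputs inherit measurability from regressors and noise through the model equation, hence only up
   to the horizon. *)
have my t k : le_hor Th t -> (k < t)%N -> mx_measurable (y k.+1).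
  move=> tT kt; have kT := le_hor_lt_hor kt tT.
  rewrite (_ : y k.+1 = fun ω => M k ω *m theta + w k ω).
    apply: mx_measurableD (mw k).
    exact: mx_measurableM (mM k) (mx_measurable_cst theta).
  by apply/funext => ω; rewrite yE.
pose a := mixture_level P cw cth delta C.
have c0 : 0 < cw ^+ 2 by exact: exprn_gt0.
have [d0 d1] := andP dlt.
have detP0 : 0 < \det (cw ^+ 2 *: P) by apply: posdef_det_gt0; exact: posdefZ.
have a0 : 0 < a.
  by rewrite /a /mixture_level !mulr_gt0 ?expR_gt0 ?invr_gt0 ?sqrtr_gt0.
(* The mixture at time 0, where $V_0 = 0$ and the estimate is [mu]; assumption (ii) then yields
   [z / a <= delta]. *)
pose z := C / Num.sqrt (\det (cw ^+ 2 *: P)) *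
  expR (wnorm P (theta - mu) ^+ 2 / cw ^+ 2 / 2).
have za : z / a <= delta.
  rewrite ler_pdivrMr// /a /mixture_level mulrCA divff ?gt_eqF// mulr1.
  rewrite ler_pM2l ?divr_gt0 ?sqrtr_gt0// ler_expR !ler_pM2r ?invr_gt0//.
  by rewrite ler_sqr ?nnegrE// sqrtr_ge0.
pose mixt t := mixture W P mu theta cw g X M y t.
have mixt_ge0 t ω : (0 <= mixt t ω)%E by exact: mixture_ge0.
have mixt0 ω : mixt 0 ω = z%:E.
  rewrite /mixt (mixtureE M y mu theta gX pW pP cw0) /theta_hat /Vmat !big_geq//.
  by rewrite !addr0 mulKmx// posdef_unitmx.
have mixt_level t ω : (mixt t ω <= a%:E)%E =
    (wnorm (P + Vmat M W t ω) (theta - theta_hat M y W P mu t ω)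
      <= beta M W P cth cw delta t ω).
  exact: (mixture_le_level M y mu theta cth C0 mX gX pW pP cw0 dlt).
have mmixt t : le_hor Th t -> measurable_fun setT (mixt t).
  by move=> tT; apply: measurable_mixture => // k; exact: my.
have mmixt_data t s : (s <= t)%N ->
    measurable_fun (setT : set (g_sigma_algebraType (data_gen M y t))) (mixt s).
  move=> st; apply: measurable_mixture => // k ks.
    by apply: mx_measurable_data_M; exact: leq_trans (ltnW ks) st.
  by apply: mx_measurable_data_y; exact: leq_trans ks st.
have mixt_step t A : lt_hor Th t -> data_sigma M y t A ->
    (\int[Pr]_(ω in A) mixt t.+1 ω <= \int[Pr]_(ω in A) mixt t ω)%E.
  move=> tT; apply: (mixture_supermartingale P mu g mX (mw t) mM) => //.
  - by move=> k; exact: (my t.+1).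
  - by move=> ω; exact: yE.
  - by move=> nu B; exact: subG.
move: mixt mixt_ge0 mixt0 mixt_level mmixt mmixt_data mixt_step.
move=> mixt mixt_ge0 mixt0 mixt_level mmixt mmixt_data mixt_step.
pose L t := mixt (stop_at Th t).
have mL t : measurable_fun setT (L t) by apply: mmixt; exact: le_hor_stop_at.
rewrite (_ : mkset _ = \bigcap_t [set ω | (L t ω <= a%:E)%E]); last first.
  apply/seteqP; split => ω /= H t => [_|tT] /=.
    by rewrite /L mixt_level; exact/H/le_hor_stop_at.
  by have := H t Logic.I; rewrite /= /L (stop_at_id tT) mixt_level.
have mE : measurable (\bigcap_t [set ω | (L t ω <= a%:E)%E]).
  by apply: bigcapT_measurable => t; exact: measurable_level.
suff PrE : (Pr (~` (\bigcap_t [set ω | (L t ω <= a%:E)%E])) <= delta%:E)%E.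
  move: PrE; rewrite probability_setC// EFinB.
  by rewrite !leeBlDr ?fin_num_measure// addeC.
apply: (@le_trans _ _ (z / a)%:E); last by rewrite lee_fin.
apply: ville_inequality => // [t ω|t|].
- exact: mixt_ge0.
(* Beyond the horizon [L] is constant; before it, stopping changes neither [t] nor [t.+1]. *)
- have [tT|tT] := pselect (lt_hor Th t); last by rewrite /L stop_at_after.
  rewrite /L (stop_at_id (lt_hor_le_hor (leqnn t) tT)) (@stop_at_id Th t.+1)//.
  apply: mixt_step => //.
  (* Staying below the level up to [t] is an event of the data at [t], as each [mixt s] with
     [s <= t] is a function of them. *)
  apply: (@bigcap_measurable _ (g_sigma_algebraType (data_gen M y t))).
    by exists 0%N.
  move=> s /= st; rewrite /L (stop_at_id (lt_hor_le_hor st tT)).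
  rewrite -[X in _.-measurable X]setTI.
  apply: (@emeasurable_fun_le _ (g_sigma_algebraType (data_gen M y t))) => //.
  exact: mmixt_data.
rewrite (eq_integral (cst z%:E)); last first.
  by move=> ω _; rewrite /L stop_at_id ?mixt0//; case: (Th).
by rewrite integral_cst//= probability_setT mule1.
Qed.
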